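(* If $G$ is a finite simple connected graph with $n$ vertices and diameter $d \geq 2$, then $$\operatorname{sg}(G) \geq \left\lceil \frac{d-3+\sqrt{(d-3)^2 + 8n(d-1)}}{2(d-1)}\right\rceil.$$
   Context: For a graph $G=(V,E)$ and a set $S\subseteq V$, for each pair of distinct vertices $\{x,y\}\subseteq S$ one selects one fixed shortest $x,y$-path $\widetilde g(x,y)$. The set $S$ is a strong geodetic set if for some such choice of fixed shortest paths, every vertex of $G$ lies on at least one of the selected paths. The strong geodetic number $\operatorname{sg}(G)$ is the minimum cardinality of a strong geodetic set of $G$. *)

(* Defs.v *)
From HB Require Import structures.
From mathcomp Require Import all_boot all_order all_algebra.
From mathcomp Require Import boolp reals.

Set Implicit Arguments.
Unset Strict Implicit.
Unset Printing Implicit Defensive.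

Definition connected (T : finType) (e : rel T) : Prop :=
  forall x y : T, connect e x y.

(* A shortest walk is a path and so has at most #|T| - 1 edges, whence the     *)
(* search range. The value is #|T| when y is not reachable from x.            *)
Definition dist (T : finType) (e : rel T) (x y : T) : nat :=
  find (fun k => [exists p : k.-tuple T, path e x p && (last x p == y)])
       (iota 0 #|T|).

Definition diameter (T : finType) (e : rel T) : nat :=
  \max_(x : T) \max_(y : T) dist e x y.

(* s is the full list of vertices, both ends included. Distinctness of the    *)
(* vertices need not be required: it follows from minimality of the length.   *)
Definition shortest_path (T : finType) (e : rel T) (x y : T) (s : seq T) :
    bool :=
  if s is z :: p then
    [&& z == x, path e x p, last x p == y & size p == dist e x y]
  else false.

(* The condition g y x = rev (g x y) says that a single path is selected for  *)
(* the unordered pair {x, y}, listed from x to y or from y to x.              *)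
Definition strong_geodetic (T : finType) (e : rel T) (S : {set T}) : Prop :=
  exists g : T -> T -> seq T,
    (forall x y : T, x \in S -> y \in S -> x != y ->
       shortest_path e x y (g x y) /\ g y x = rev (g x y)) /\
    (forall v : T, exists x y : T,
       [/\ x \in S, y \in S, x != y & v \in g x y]).

(* The arg min needs a default, which must satisfy the predicate for the      *)
(* result to be a minimizer: [set: T] is a strong geodetic set of any         *)
(* connected graph with at least two vertices.                                *)
Definition sg (T : finType) (e : rel T) : nat :=
  #|[arg min_(S < [set: T] | `[< strong_geodetic e S >]) #|S|]|.

(* Main.v *)
(** Each pair of vertices of a strong geodetic set [S] of size [s] contributes
    at most [d - 1] vertices outside [S], the interior of its path, so
    [n <= s + 'C(s, 2) * (d - 1)].  Reading this as the quadratic inequality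
    [(d - 1) s^2 - (d - 3) s - 2 n >= 0] in [s] gives the bound. *)
Require Import Defs.
From HB Require Import structures.
From mathcomp Require Import all_boot all_order all_algebra.
From mathcomp Require Import boolp reals.
From mathcomp Require Import ring lra.

Set Implicit Arguments.
Unset Strict Implicit.
Unset Printing Implicit Defensive.

Import Order.TTheory GRing.Theory Num.Theory.
Local Open Scope ring_scope.

Lemma dist_le_diameter (T : finType) (e : rel T) (x y : T) :
  (dist e x y <= diameter e)%N.
Proof.
rewrite /diameter; apply: leq_trans (leq_bigmax x).
exact: (leq_bigmax (F := dist e x) y).
Qed.

Lemma diameter_gt0_card (T : finType) (e : rel T) :
  (0 < diameter e)%N -> (0 < #|T|)%N.
Proof.
rewrite !lt0n; apply: contra_neq => /card0_eq T0.
by rewrite /diameter big_pred0.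
Qed.

(** The path lists [dist e x y + 1] vertices. Since [x != y], its first and last entries are
    separate, and removing both leaves [dist e x y - 1] entries. *)
Lemma card_interior_shortest_path (T : finType) (e : rel T) (x y : T)
    (s : seq T) :
  x != y -> shortest_path e x y s ->
  (#|[set v in s | (v != x) && (v != y)]| <= (diameter e).-1)%N.
Proof.
case: s => // z p neq_xy /and4P[/eqP -> _].
case/lastP: p => [/= /eqP xy|q w]; first by rewrite xy eqxx in neq_xy.
rewrite last_rcons size_rcons => /eqP -> /eqP size_q.
apply: (@leq_trans (size q)); last first.
  by rewrite -ltnS (leq_trans _ (leqSpred _)) // size_q dist_le_diameter.
apply: leq_trans (card_size q); apply/subset_leq_card/subsetP => v.
rewrite !inE mem_rcons inE.
by case: (v == x); case: (v == y); rewrite ?andbF ?andbT.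
Qed.

Lemma card_bigcup_le (I T : finType) (P : {set I}) (W : I -> {set T}) (m : nat) :
  (forall i, i \in P -> #|W i| <= m)%N ->
  (#|\bigcup_(i in P) W i| <= #|P| * m)%N.
Proof.
move=> leW; apply: leq_trans (_ : \sum_(i in P) #|W i| <= _)%N; last first.
  by rewrite -sum_nat_const leq_sum.
apply: (big_ind2 (fun (A : {set T}) k => #|A| <= k)%N) => //.
  by rewrite cards0.
move=> A k B l leA leB.
by apply: leq_trans (leq_add leA leB); rewrite cardsU leq_subr.
Qed.

Lemma strong_geodetic_card (T : finType) (e : rel T) (S : {set T}) :
  strong_geodetic e S ->
  (#|T| <= #|S| + 'C(#|S|, 2) * (diameter e).-1)%N.
Proof.
case=> g [g_path g_cover].
rewrite -(cardsC S) leq_add2l.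
(* Indexing by 2-subsets rather than ordered pairs yields the factor ['C(#|S|, 2)]. A set [A] has no
   orientation, so [W A] collects from the paths listed in both directions. *)
pose W (A : {set T}) := [set v in ~: S |
  [exists x in A, exists y in A, (x != y) && (v \in g x y)]].
pose P := [set A : {set T} | A \subset S & #|A| == 2].
rewrite -cards_draws -/P.
apply: leq_trans (_ : #|\bigcup_(A in P) W A| <= _)%N.
  apply/subset_leq_card/subsetP => v vS.
  have [x [y [xS yS neq_xy v_g]]] := g_cover v.
  apply/bigcupP; exists [set x; y].
    by rewrite !inE cards2 neq_xy eqxx andbT subUset !sub1set xS yS.
  rewrite inE vS /=; apply/existsP; exists x; rewrite set21 /=.
  by apply/existsP; exists y; rewrite set22 neq_xy.
apply: card_bigcup_le => A; rewrite inE => /andP[AS /cards2P[x [y [neq_xy A_xy]]]].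
move: AS; rewrite A_xy subUset !sub1set => /andP[xS yS].
have [xy_path g_yx] := g_path x y xS yS neq_xy.
apply: leq_trans (card_interior_shortest_path neq_xy xy_path).
apply/subset_leq_card/subsetP => v /setIdP[vS].
have [vx vy] : v != x /\ v != y.
  by split; apply: contraTneq vS => ->; rewrite inE negbK.
rewrite inE vx vy !andbT.
(* Either [(a, b)] is [(x, y)], or it is [(y, x)] and [g y x] is the reversed list, with the same
   vertices. *)
case/existsP=> a /andP[+ /existsP[b /and3P[+ neq_ab]]].
rewrite !in_set2 => /orP[]/eqP a_xy /orP[]/eqP b_xy; move: neq_ab.
all: by rewrite a_xy b_xy ?eqxx // g_yx mem_rev.
Qed.

(* If no set is strong geodetic, [sg] is the junk value [#|T|], for which the
   bound is trivial; this spares proving that [[set: T]] is strong geodetic. *)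
Lemma card_le_sg (T : finType) (e : rel T) :
  (#|T| <= sg e + 'C(sg e, 2) * (diameter e).-1)%N.
Proof.
rewrite /sg /arg_min /extremum; case: pickP => [S /andP[/asboolP geoS _]|_] /=.
  exact: strong_geodetic_card geoS.
by rewrite cardsT leq_addr.
Qed.

(** Completing the square: [(2as + b)^2] exceeds the discriminant by [4a(as^2 + bs + c)]. The second
    hypothesis places [s] at or to the right of the vertex, so taking square roots bounds [s] by the
    larger root. *)
Lemma quadratic_root_le (R : rcfType) (a b c s : R) :
  0 < a -> 0 <= 2 * a * s + b -> 0 <= a * s ^+ 2 + b * s + c ->
  (- b + Num.sqrt (b ^+ 2 - 4 * a * c)) / (2 * a) <= s.
Proof.
move=> a_gt0 vertex_le ge0.
rewrite ler_pdivrMr ?mulr_gt0 // addrC lerBlDr.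
rewrite (_ : s * (2 * a) + b = 2 * a * s + b); last by ring.
rewrite -[leRHS](ger0_norm vertex_le) -sqrtr_sqr ler_wsqrtr // -subr_ge0.
rewrite (_ : _ - _ = 4 * a * (a * s ^+ 2 + b * s + c)); last by ring.
by rewrite !mulr_ge0 // ltW.
Qed.

Theorem theorem3p4 (R : realType) (T : finType) (e : rel T) (n d : nat)
    (e_sym : symmetric e) (e_irr : irreflexive e) (e_conn : connected e)
    (cardT : #|T| = n) (diamT : diameter e = d) (d_ge2 : (2 <= d)%N) :
  Num.ceil ((d%:R - 3 + Num.sqrt ((d%:R - 3) ^+ 2 + 8 * n%:R * (d%:R - 1)))
            / (2 * (d%:R - 1)) : R) <= (sg e)%:Z.
Proof.
have n_gt0 : (0 < n)%N by rewrite -cardT (@diameter_gt0_card _ e) // diamT ltnW.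
have := card_le_sg e; rewrite cardT diamT.
move: (sg e) => s n_le.
(* For [s = 0] the counting bound would read [n <= 0]. *)
have s_gt0 : (0 < s)%N by case: s n_le => // /(leq_trans n_gt0).
have bin2R : 2 * ('C(s, 2))%:R = s%:R * (s%:R - 1) :> R.
  rewrite -natrM mulnC -[2%N]/(2`!) bin_ffact ffactnS ffactn1 natrM.
  by rewrite -subn1 natrB.
have n_leR : n%:R <= s%:R + ('C(s, 2))%:R * (d%:R - 1) :> R.
  by rewrite -(natrB _ (ltnW d_ge2)) subn1 -natrM -natrD ler_nat.
have dR : 2 <= d%:R :> R by rewrite ler_nat.
have sR : 1 <= s%:R :> R by rewrite ler1n.
rewrite ceil_le_int -pmulrn.
have -> : d%:R - 3 = - (3 - d%:R) :> R by ring.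
have -> : (- (3 - d%:R)) ^+ 2 + 8 * n%:R * (d%:R - 1)
    = (3 - d%:R) ^+ 2 - 4 * (d%:R - 1) * (- 2 * n%:R) :> R by ring.
(* Here [a = d - 1], [b = 3 - d], [c = -2n]. The vertex condition holds because [s >= 1] gives
   [2(d - 1)s + 3 - d >= d + 1]. *)
apply: quadratic_root_le; [lra|nra|].
(* The quadratic is twice the slack in [n_leR], the doubling clearing the denominator of the
   binomial. *)
have -> : (d%:R - 1) * s%:R ^+ 2 + (3 - d%:R) * s%:R + - 2 * n%:R
    = 2 * s%:R + s%:R * (s%:R - 1) * (d%:R - 1) - 2 * n%:R :> R by ring.
by rewrite -bin2R -mulrA -mulrDr -mulrBr mulr_ge0 // subr_ge0.
Qed.
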